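(* Consider the $1+1$ dimensional Lagrangian density for $N$ scalar fields $\phi_1,\dots,\phi_N$ $$\mathcal{L}=-\sqrt{g_0(\phi)-\sum_{i=1}^N g_i(\phi)\left[(\partial_t\phi_i)^2-(\phi_i')^2\right]}-V(\phi).$$ Let $\phi(x)$, $x\in\mathbb{R}$, be a smooth static configuration, let $E=-\int\mathcal{L}\,dx$ be its energy, and let $E(\lambda)$ be the energy of $\phi(\lambda x)$, assumed finite for $\lambda$ near $1$ and differentiable under the integral sign after the change of variables $x\to x/\lambda$. Then $$\left.\frac{dE(\lambda)}{d\lambda}\right|_{\lambda=1}=-\int dx\left\{V(\phi)+\frac{g_0(\phi)}{\sqrt{g_0(\phi)+\sum_{i=1}^N g_i(\phi)(\phi_i')^2}}\right\},$$ and the expression in braces equals the ''energy'' $\sum_i\phi_i'\frac{\partial \mathcal{L}}{\partial\phi_i'}-\mathcal{L}$ of the $0+1$ dimensional system obtained from $\mathcal{L}$ on static configurations by regarding $x$ as time. In particular, static configurations for which this ''energy'' vanishes identically satisfy Derrick's condition $\left.dE/d\lambda\right|_{\lambda=1}=0$.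
   Context: $g_0,g_1,\dots,g_N$ and $V$ are smooth functions of $\phi=(\phi_1,\dots,\phi_N)$ with no explicit dependence on $x$, with $g_0>0$ and the argument of the square root positive on the configurations considered; $\phi_i'=d\phi_i/dx$. A static configuration has $\partial_t\phi_i=0$. *)

(* Defs.v *)
From HB Require Import structures.
From mathcomp Require Import all_boot all_order all_algebra.
From mathcomp Require Import all_classical all_reals all_analysis.

Set Implicit Arguments.
Unset Strict Implicit.
Unset Printing Implicit Defensive.

Import Order.TTheory GRing.Theory Num.Theory.
Import numFieldNormedType.Exports.

Local Open Scope classical_set_scope.
Local Open Scope ring_scope.

(* C^k maps through iterated directional derivatives.  In finite dimension,
   the only case used, continuity of all directional derivatives of order at
   most k is the usual C^k property. *)
Fixpoint of_class_C (R : realType) (V W : normedModType R) (k : nat)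
    (f : V -> W) : Prop :=
  match k with
  | 0%N => continuous f
  | k'.+1 => continuous f /\
      (forall v : V, (forall a : V, derivable f a v) /\
                     of_class_C k' (fun a => 'D_v f a))
  end.

Definition smooth (R : realType) (V W : normedModType R) (f : V -> W) : Prop :=
  forall k, of_class_C k f.

(* l |-> \int F l x dx may be differentiated at l0 under the integral sign:
   the derivative at l0 exists and is the (absolutely convergent) integral of
   the partial derivative of F in l. *)
Definition differentiable_under_integral (R : realType) (F : R -> R -> R)
    (l0 : R) : Prop :=
  [/\ (forall x, derivable (F ^~ x) l0 1),
      (@lebesgue_measure R).-integrable setT
        (fun x : R => (derive1 (F ^~ x) l0)%:E) &
      is_derive l0 1 (fun l => \int[@lebesgue_measure R]_x F l x)
        (\int[@lebesgue_measure R]_x derive1 (F ^~ x) l0)].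

Section KEssence.
Context (R : realType) (N : nat).
Variables (g0 : 'rV[R]_N -> R) (g : 'I_N -> 'rV[R]_N -> R) (V : 'rV[R]_N -> R).

(* u, ut, ux are the values of phi, of its time and of its space derivative. *)
Definition root_argument (u ut ux : 'rV[R]_N) : R :=
  g0 u - \sum_(i < N) g i u * (ut 0 i ^+ 2 - ux 0 i ^+ 2).

Definition lagrangian (u ut ux : 'rV[R]_N) : R :=
  - Num.sqrt (root_argument u ut ux) - V u.

(* Static configurations are the maps of x alone: their time derivative is 0. *)
Definition admissible (phi : R -> 'rV[R]_N) : Prop :=
  forall x, 0 < g0 (phi x) /\ 0 < root_argument (phi x) 0 (derive1 phi x).

Definition static_density (phi : R -> 'rV[R]_N) (x : R) : R :=
  lagrangian (phi x) 0 (derive1 phi x).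

Definition finite_energy (phi : R -> 'rV[R]_N) : Prop :=
  (@lebesgue_measure R).-integrable setT
    (fun x : R => (static_density phi x)%:E).

Definition energy (phi : R -> 'rV[R]_N) : R :=
  - \int[@lebesgue_measure R]_x static_density phi x.

Definition rescale (phi : R -> 'rV[R]_N) (l : R) : R -> 'rV[R]_N :=
  fun x => phi (l * x).

(* The Lagrangian density of phi(l x) after the change of variables x -> x/l,
   which contributes the Jacobian 1/l. *)
Definition rescaled_density (phi : R -> 'rV[R]_N) (l x : R) : R :=
  l^-1 * static_density (rescale phi l) (x / l).

(* The energy q' dL/dq' - L of the mechanical system with Lagrangian
   (q, q') |-> lagrangian q 0 q' and time x; the derivative in the i-th
   velocity is the derivative along the i-th basis vector. *)
Definition mechanical_energy (q q' : 'rV[R]_N) : R :=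
  \sum_(i < N) q' 0 i * 'D_(delta_mx 0 i) (lagrangian q 0) q'
  - lagrangian q 0 q'.

Definition virial_density (phi : R -> 'rV[R]_N) (x : R) : R :=
  V (phi x) + g0 (phi x) /
    Num.sqrt (g0 (phi x) +
              \sum_(i < N) g i (phi x) * (derive1 phi x) 0 i ^+ 2).

End KEssence.

(* Main.v *)
(** After the change of variables [x -> x / l], the scale [l] enters the density
    only through the Jacobian and the factor [l ^ 2] in front of the gradient
    term [S], giving [l^-1 * (- sqrt (g0 + l ^ 2 * S) - V)].  Its derivative at
    [l = 1] is [sqrt (g0 + S) + V - S / sqrt (g0 + S)].  This is also
    [q' dL/dq' - L], because [S] is quadratic in the velocities, and it equals
    [V + g0 / sqrt (g0 + S)]. *)
Require Import Defs.
From HB Require Import structures.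
From mathcomp Require Import all_boot all_order all_algebra.
From mathcomp Require Import all_classical all_reals all_analysis.
From mathcomp Require Import ring.

Set Implicit Arguments.
Unset Strict Implicit.
Unset Printing Implicit Defensive.

Import Order.TTheory GRing.Theory Num.Theory.
Import numFieldNormedType.Exports.

Local Open Scope classical_set_scope.
Local Open Scope ring_scope.

(** The two difference quotients coincide term by term. This reduces a partial derivative in a
    velocity to one-variable calculus in [h]. *)
Lemma is_derive_line (R : realType) (U W : normedModType R) (f : U -> W)
    (a v : U) (d : W) :
  is_derive (0 : R) 1 (fun h : R => f (h *: v + a)) d -> is_derive a v f d.
Proof.
have E : (fun h : R => h^-1 *: (((fun h : R => f (h *: v + a)) \o shift 0)
            (h *: 1) - f ((0 : R) *: v + a)))
       = (fun h : R => h^-1 *: ((f \o shift a) (h *: v) - f a)).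
  by apply/funext => h /=; rewrite addr0 [h *: 1]mulr1 scale0r add0r.
case; rewrite /derivable /derive E => ex <-.
exact: DeriveDef.
Qed.

Lemma derive1_rescale (R : realType) (N : nat) (phi : R -> 'rV[R]_N) (l x : R) :
  derivable phi (l * x) 1 ->
  derive1 (rescale phi l) x = l *: derive1 phi (l * x).
Proof.
move=> /derivable1_diffP dphi.
have dl : is_derive x 1 (fun y : R => l * y) l.
  by apply: is_derive_eq; rewrite [LHS]mulr1.
have /derivable1_diffP dl' := @ex_derive _ _ _ _ _ _ _ dl.
have -> : rescale phi l = phi \o (fun y : R => l * y) by [].
rewrite !derive1E' //; last exact: differentiable_comp.
have E1 : 'd (fun y : R => l * y) x 1 = l.
  by rewrite -(derive1E' dl') derive1E (@derive_val _ _ _ _ _ _ _ dl).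
(* The chain rule is applied to differentials; linearity of ['d phi (l * x)] then brings the factor
   [l] out. *)
transitivity ('d phi (l * x) ('d (fun y : R => l * y) x 1)).
  exact: (congr1 (fun h : R -> 'rV[R]_N => h 1) (diff_comp dl' dphi)).
by rewrite E1 -linearZ; congr ('d _ _ _); rewrite [RHS]mulr1.
Qed.

(** Substitution for nonnegative functions, applied to the positive and negative parts of [f],
    equates the extended-real integrals. Hence the identity holds for any continuous [f], whether or
    not it is integrable. *)
Lemma Rintegral_rescale (R : realType) (f : R -> R) (l : R) :
  0 < l -> continuous f ->
  \int[@lebesgue_measure R]_x (l^-1 * f (x / l)) =
  \int[@lebesgue_measure R]_x f x.
Proof.
move=> l0 cf; rewrite /Rintegral; congr fine.
have li0 : 0 < l^-1 by rewrite invr_gt0.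
pose F := fun x : R => x / l.
have dF (x : R) : is_derive x 1 F l^-1.
  by apply: is_derive_eq; rewrite scaler0 add0r [LHS]mulr1.
have F'E : derive1 F = cst l^-1.
  by apply/funext => x; rewrite derive1E (@derive_val _ _ _ _ _ _ _ (dF x)).
have subst (G : R -> R) : continuous G -> (forall x, 0 <= G x) ->
    (\int[@lebesgue_measure R]_x (G x)%:E =
     \int[@lebesgue_measure R]_x (l^-1 * G (x / l))%:E)%E.
  move=> cG G0; rewrite (@increasing_ge0_integration_by_substitutionT R F G) //.
  - by apply: eq_integral => x _; rewrite F'E /= mulrC.
  - by move=> x y xy; rewrite /F ltr_pM2r.
  - by rewrite F'E; exact: cst_continuous.
  - by rewrite F'E; exact: is_cvg_cst.
  - by rewrite F'E; exact: is_cvg_cst.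
  - exact: gt0_cvgMlNy.
  - exact: gt0_cvgMly.
(* As [l^-1] is positive, multiplying by it commutes with taking positive and negative parts. *)
rewrite [LHS]integralE [RHS]integralE; congr (_ - _)%E.
- transitivity (\int[@lebesgue_measure R]_x (Num.max (f x) 0)%:E)%E; last first.
    by apply: eq_integral => x _; rewrite funeposE -EFin_max.
  rewrite subst //; last by move=> x; rewrite le_max lexx orbT.
    apply: eq_integral => x _.
    by rewrite funeposE -EFin_max maxr_pMr ?mulr0// ltW.
  by move=> x; apply: continuous_max; [exact: cf|exact: cvg_cst].
- transitivity (\int[@lebesgue_measure R]_x (Num.max (- f x) 0)%:E)%E; last first.
    by apply: eq_integral => x _; rewrite funenegE -EFinN -EFin_max.
  rewrite subst //; last by move=> x; rewrite le_max lexx orbT.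
    apply: eq_integral => x _.
    by rewrite funenegE -EFinN -EFin_max maxr_pMr ?mulr0 ?mulrN// ltW.
  move=> x; apply: (@continuous_max _ _ (fun y => - f y)); last exact: cvg_cst.
  by apply: continuousN; exact: cf.
Qed.

Lemma is_derive_rescaled_root (R : realType) (a s v : R) : 0 < a + s ->
  is_derive (1 : R) 1 (fun l => l^-1 * (- Num.sqrt (a + l ^+ 2 * s) - v))
    (v + a / Num.sqrt (a + s)).
Proof.
move=> as0.
have Dr : is_derive (1 : R) 1 (fun l : R => a + l ^+ 2 * s) (2 * s).
  apply: is_derive_eq; rewrite /GRing.scale /=; ring.
have Ds : is_derive (1 : R) 1 (fun l : R => Num.sqrt (a + l ^+ 2 * s))
    ((2 * Num.sqrt (a + s))^-1 * (2 * s)).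
  apply: (@is_derive1_comp _ Num.sqrt (fun l : R => a + l ^+ 2 * s)).
  rewrite expr1n mul1r; exact: is_derive1_sqrt.
have Di : is_derive (1 : R) 1 (fun l : R => l^-1) (-1).
  have := is_deriveV (oner_neq0 R) (is_derive_id (1 : R) 1).
  by rewrite expr1n invr1 [_ *: _]mulr1.
apply: is_derive_eq.
rewrite /GRing.scale /= invr1 expr1n mul1r.
have rE := sqr_sqrtr (ltW as0).
have r0 : Num.sqrt (a + s) != 0 by rewrite gt_eqF// sqrtr_gt0.
(* With [r] the root, [a = r ^ 2 - s] turns the claim into a rational identity in [r], [s], [v]. The
   rewrite also reaches the [a] under the root, so the next line folds [sqrt (r ^ 2 - s + s)] back
   to [r]. *)
have -> : a = Num.sqrt (a + s) ^+ 2 - s by rewrite rE addrK.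
rewrite subrK sqrtr_sqr ger0_norm ?sqrtr_ge0//.
by field.
Qed.

Section Static.
Context (R : realType) (N : nat).
Variables (g0 : 'rV[R]_N -> R) (g : 'I_N -> 'rV[R]_N -> R) (V : 'rV[R]_N -> R).

Lemma root_argument_static (u ux : 'rV[R]_N) :
  root_argument g0 g u 0 ux = g0 u + \sum_(i < N) g i u * ux 0 i ^+ 2.
Proof.
rewrite /root_argument -sumrN; congr (_ + _); apply: eq_bigr => i _.
by rewrite mxE expr0n sub0r mulrN opprK.
Qed.

(** This supplies the continuity that [Rintegral_rescale] asks for; [Num.sqrt] is continuous on the
    whole line, whatever the sign of the radicand. *)
Lemma continuous_static_density (phi : R -> 'rV[R]_N) :
  continuous g0 -> (forall i, continuous (g i)) -> continuous V ->
  continuous phi -> continuous (derive1 phi) ->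
  continuous (static_density g0 g V phi).
Proof.
move=> cg0 cg cV cphi cdphi x.
have cc (h : 'rV[R]_N -> R) : continuous h -> {for x, continuous (h \o phi)}.
  by move=> ch; apply: continuous_comp; [exact: cphi|exact: ch].
pose r y := g0 (phi y) + \sum_(i < N) g i (phi y) * (derive1 phi y) 0 i ^+ 2.
have -> : static_density g0 g V phi = fun y => - Num.sqrt (r y) - V (phi y).
  apply/funext => y.
  by rewrite /static_density /lagrangian root_argument_static.
suff cr : {for x, continuous r}.
  apply: cvgB; last exact: cc.
  by apply: cvgN; apply: (continuous_comp cr); exact: sqrt_continuous.
apply: cvgD; first exact: cc.
apply: cvg_big => [y|i _]; first exact: add_continuous.
apply: cvgM; first exact: cc.
apply: (@continuous_comp _ _ _
  (fun y => (derive1 phi y) 0 i) (fun z => z ^+ 2));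
  last exact: exprn_continuous.
apply: (@continuous_comp _ _ _ (derive1 phi) (fun M : 'rV[R]_N => M 0 i)).
  exact: cdphi.
exact: coord_continuous.
Qed.

Lemma is_derive_lagrangian_velocity (q q' : 'rV[R]_N) (i : 'I_N) :
  0 < root_argument g0 g q 0 q' ->
  is_derive q' (delta_mx 0 i) (lagrangian g0 g V q 0)
    (- (g i q * q' 0 i / Num.sqrt (root_argument g0 g q 0 q'))).
Proof.
set A := root_argument _ _ _ _ _ => A0; apply: is_derive_line.
(* Moving along the [i]-th basis vector changes only the [i]-th square, by
   [(q'_i + h) ^ 2 - q'_i ^ 2]. *)
have E (h : R) : lagrangian g0 g V q 0 (h *: delta_mx 0 i + q') =
    - Num.sqrt (A + g i q * (2 * h * q' 0 i + h ^+ 2)) - V q.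
  rewrite /lagrangian; congr (- Num.sqrt _ - _).
  rewrite /A !root_argument_static (bigD1 i) //= [in RHS](bigD1 i) //=.
  rewrite !mxE !eqxx mulr1.
  rewrite (eq_bigr (fun j => g j q * q' 0 j ^+ 2)); first by ring.
  by move=> j ji; rewrite !mxE (negPf ji) andbF mulr0 add0r.
under eq_fun do rewrite E.
have Dr : is_derive (0 : R) 1
    (fun h : R => A + g i q * (2 * h * q' 0 i + h ^+ 2)) (2 * (g i q * q' 0 i)).
  apply: is_derive_eq; rewrite /GRing.scale /=; ring.
have Ds : is_derive (0 : R) 1
    (fun h : R => Num.sqrt (A + g i q * (2 * h * q' 0 i + h ^+ 2)))
    ((2 * Num.sqrt A)^-1 * (2 * (g i q * q' 0 i))).
  apply: (@is_derive1_comp _ Num.sqrt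
    (fun h : R => A + g i q * (2 * h * q' 0 i + h ^+ 2))).
  rewrite mulr0 mul0r expr0n addr0 mulr0 addr0; exact: is_derive1_sqrt.
apply: is_derive_eq.
have r0 : Num.sqrt A != 0 by rewrite gt_eqF// sqrtr_gt0.
by field.
Qed.

(** Each velocity times its momentum is minus the matching summand of [s] over the root, so these
    terms add up to [- s / sqrt (a + s)]; subtracting the Lagrangian contributes
    [sqrt (a + s) + V]. *)
Lemma mechanical_energy_virial (phi : R -> 'rV[R]_N) (x : R) :
  0 < root_argument g0 g (phi x) 0 (derive1 phi x) ->
  mechanical_energy g0 g V (phi x) (derive1 phi x) =
  virial_density g0 g V phi x.
Proof.
move=> A0; rewrite /mechanical_energy /virial_density /lagrangian.
under eq_bigr => i _ do rewrite
  (@derive_val _ _ _ _ _ _ _ (is_derive_lagrangian_velocity i A0)).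
move: A0; rewrite root_argument_static.
set s := \sum_(i < N) g _ _ * _; set a := g0 _ => as0.
rewrite (eq_bigr (fun i : 'I_N => g i (phi x) * derive1 phi x 0 i ^+ 2 *
  - (Num.sqrt (a + s))^-1)); last by move=> i _; ring.
rewrite -mulr_suml -/s.
have r0 : Num.sqrt (a + s) != 0 by rewrite gt_eqF// sqrtr_gt0.
have rE := sqr_sqrtr (ltW as0).
have -> : a / Num.sqrt (a + s) = Num.sqrt (a + s) - s / Num.sqrt (a + s).
  by rewrite -[X in X / _](addrK s) -{1}rE; field.
by ring.
Qed.

(** Evaluating [rescale phi l] at [x / l] gives back [phi x], so [l] survives only in the Jacobian
    and, squared, through the chain rule. *)
Lemma rescaled_densityE (phi : R -> 'rV[R]_N) (l x : R) :
  l != 0 -> derivable phi x 1 ->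
  rescaled_density g0 g V phi l x =
  l^-1 * (- Num.sqrt (g0 (phi x) + l ^+ 2 *
            \sum_(i < N) g i (phi x) * (derive1 phi x) 0 i ^+ 2) - V (phi x)).
Proof.
move=> l0 dphi; rewrite /rescaled_density /static_density /lagrangian.
have lx : l * (x / l) = x by rewrite mulrCA mulfV // mulr1.
rewrite derive1_rescale ?lx // root_argument_static /rescale lx mulr_sumr.
congr (_ * (- Num.sqrt (_ + _) - _)); apply: eq_bigr => i _.
by rewrite mxE exprMn mulrCA.
Qed.

Lemma is_derive_rescaled_density (phi : R -> 'rV[R]_N) (x : R) :
  derivable phi x 1 -> 0 < root_argument g0 g (phi x) 0 (derive1 phi x) ->
  is_derive (1 : R) 1 (fun l => rescaled_density g0 g V phi l x)
    (virial_density g0 g V phi x).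
Proof.
rewrite root_argument_static => dphi A0.
(* The closed form requires [l != 0], which holds in a neighbourhood of 1, and the derivative
   depends only on such a neighbourhood. *)
apply: near_eq_is_derive (is_derive_rescaled_root _ A0).
near=> l.
have l0 : (0 : R) < l by near: l; exact: (lt_nbhsr ltr01).
by rewrite rescaled_densityE// gt_eqF.
Unshelve. all: by end_near. Qed.

Lemma energy_rescale (phi : R -> 'rV[R]_N) (l : R) :
  continuous g0 -> (forall i, continuous (g i)) -> continuous V ->
  continuous phi -> (forall x, derivable phi x 1) -> continuous (derive1 phi) ->
  0 < l ->
  energy g0 g V (rescale phi l) =
  - \int[@lebesgue_measure R]_x rescaled_density g0 g V phi l x.
Proof.
move=> cg0 cg cV cphi dphi cdphi l0; congr (- _); apply: esym.
apply: (@Rintegral_rescale _ (static_density g0 g V (rescale phi l))) => //.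
have cl (W : topologicalType) (f : R -> W) :
    continuous f -> continuous (fun x => f (l * x)).
  move=> cf x; apply: (@continuous_comp _ _ _ ( *%R l) f); last exact: cf.
  exact: mulrl_continuous.
apply: (continuous_static_density cg0 cg cV); first exact: cl.
have -> : derive1 (rescale phi l) = fun x => l *: derive1 phi (l * x).
  by apply/funext => x; exact: derive1_rescale.
by move=> x; apply: cvgZl_tmp; exact: cl.
Qed.

End Static.

Theorem mainTheorem6 (R : realType) (N : nat)
  (g0 : 'rV[R]_N -> R) (g : 'I_N -> 'rV[R]_N -> R) (V : 'rV[R]_N -> R)
  (g0_smooth : smooth g0) (g_smooth : forall i, smooth (g i))
  (V_smooth : smooth V)
  (phi : R -> 'rV[R]_N) (phi_smooth : smooth phi)
  (phi_adm : \forall l \near (1 : R), admissible g0 g (rescale phi l))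
  (phi_fin : \forall l \near (1 : R), finite_energy g0 g V (rescale phi l))
  (phi_diff : differentiable_under_integral (rescaled_density g0 g V phi) 1) :
  [/\ (@lebesgue_measure R).-integrable setT
        (fun x : R => (virial_density g0 g V phi x)%:E)
      /\ is_derive (1 : R) 1 (fun l => energy g0 g V (rescale phi l))
           (- \int[@lebesgue_measure R]_x virial_density g0 g V phi x),
      forall x : R,
        (forall i : 'I_N,
           derivable (lagrangian g0 g V (phi x) 0) (derive1 phi x) (delta_mx 0 i))
        /\ mechanical_energy g0 g V (phi x) (derive1 phi x)
           = virial_density g0 g V phi x &
      (forall x : R, mechanical_energy g0 g V (phi x) (derive1 phi x) = 0) ->
        is_derive (1 : R) 1 (fun l => energy g0 g V (rescale phi l)) 0].
Proof.
have [cphi /(_ 1) [dphi cdphi]] := phi_smooth 1%N.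
have {}cdphi : continuous (derive1 phi).
  by have -> : derive1 phi = 'D_1 phi by apply/funext => x; rewrite derive1E.
have phi1 : rescale phi 1 = phi by apply/funext => x; rewrite /rescale mul1r.
(* A property valid near 1 holds at [l = 1], where the rescaling is the identity. *)
have root_gt0 x : 0 < root_argument g0 g (phi x) 0 (derive1 phi x).
  by have := nbhs_singleton phi_adm x; rewrite phi1 => -[].
have DF x : derive1 (rescaled_density g0 g V phi ^~ x) 1 =
    virial_density g0 g V phi x.
  rewrite derive1E.
  exact: (@derive_val _ _ _ _ _ _ _
    (is_derive_rescaled_density V (dphi x) (root_gt0 x))).
have mechE x := mechanical_energy_virial V (root_gt0 x).
(* By [DF], the derivative under the integral sign is the virial density, both in the integrability
   claim and in the value of the derivative. *)
case: phi_diff => _.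
under eq_fun do rewrite DF.
under eq_Rintegral do rewrite DF.
move=> virial_int dI.
have dE : is_derive (1 : R) 1 (fun l => energy g0 g V (rescale phi l))
    (- \int[@lebesgue_measure R]_x virial_density g0 g V phi x).
  (* The energy and minus the integral of the rescaled density agree for all [l > 0], hence near
     1. *)
  apply: near_eq_is_derive (is_deriveN dI).
  near=> l.
  have l0 : (0 : R) < l by near: l; exact: (lt_nbhsr ltr01).
  have cg0 : continuous g0 := g0_smooth 0%N.
  have cg i : continuous (g i) := g_smooth i 0%N.
  have cV : continuous V := V_smooth 0%N.
  by rewrite (energy_rescale cg0 cg cV cphi dphi cdphi l0).
split => [//|x|mech0].
  split=> [i|]; last exact: mechE.
  exact: (@ex_derive _ _ _ _ _ _ _
    (is_derive_lagrangian_velocity V i (root_gt0 x))).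
apply: is_derive_eq dE _.
(* The integrand becomes the constant 0, whose integral is 0 times [fine] of the measure of the
   line, hence 0 although that measure is infinite. *)
under eq_Rintegral do rewrite -mechE mech0.
by rewrite Rintegral_cst// mul0r oppr0.
Unshelve. all: by end_near. Qed.
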